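(* Let $X=[0,1]^{\mathbb N_0}$ with the shift $\sigma$, let $h\in C^2([0,1]^2;\mathbb R)$ satisfy $D_2D_1h<0$ on $[0,1]^2$, and let $\varphi:X\to\mathbb R$ be given by $\varphi(\underline{x})=h(x_0,x_1)$. Then \[\mathscr{M}_\varphi=\Omega_\varphi=\bigcup_{a\in\mathrm{m}_h}\{a^\infty\}.\]
   Context: $X=[0,1]^{\mathbb N_0}$ carries the metric $d_X(\underline{x},\underline{y})=\sum_{i\ge0}|x_i-y_i|/2^{i+1}$, and $\sigma(\underline{x})_i=x_{i+1}$. For Lipschitz $\varphi:X\to\mathbb R$, $\alpha_\varphi=\inf_\mu\int\varphi\,d\mu$, the infimum over $\sigma$-invariant Borel probability measures; a measure attaining it is called minimizing, and the Mather set $\mathscr{M}_\varphi$ is the union of the supports of all minimizing measures. For $\underline{x},\underline{y}\in X$, $n\in\mathbb N$, $\varepsilon>0$ let $B(\underline{x},\underline{y},n;\varepsilon)=\{\underline{z}\in X: d_X(\underline{x},\underline{z})<\varepsilon,\ d_X(\sigma^n\underline{z},\underline{y})<\varepsilon\}$, $S_\varphi(\underline{x},\underline{y};\varepsilon)=\inf\{\sum_{i=0}^{n-1}(\varphi(\sigma^i\underline{z})-\alpha_\varphi): n\in\mathbb N,\ \underline{z}\in B(\underline{x},\underline{y},n;\varepsilon)\}$ and $S_\varphi(\underline{x},\underline{y})=\lim_{\varepsilon\to0}S_\varphi(\underline{x},\underline{y};\varepsilon)$ (the Mañé potential). The Aubry set is $\Omega_\varphi=\{\underline{x}\in X: S_\varphi(\underline{x},\underline{x})=0\}$.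 For $h:[0,1]^2\to\mathbb R$ continuous, $h^*=\min_{x\in[0,1]}h(x,x)$ and $\mathrm{m}_h=\{a\in[0,1]: h(a,a)=h^*\}$; $a^\infty$ denotes the constant sequence $aaa\ldots$. $D_i$ denotes the partial derivative in the $i$-th variable. *)

(* Defs.v *)
From HB Require Import structures.
From mathcomp Require Import all_boot all_order all_algebra.
From mathcomp Require Import all_classical all_reals all_analysis.
Import Order.TTheory GRing.Theory Num.Theory.
Import numFieldNormedType.Exports.
Set Implicit Arguments.
Unset Strict Implicit.
Unset Printing Implicit Defensive.
Local Open Scope classical_set_scope.
Local Open Scope ring_scope.

Definition X (R : realType) := {x : nat -> R | forall i, 0 <= x i <= 1}.
HB.instance Definition _ (R : realType) := gen_eqMixin (X R).
HB.instance Definition _ (R : realType) := gen_choiceMixin (X R).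
Lemma X0P (R : realType) : forall i : nat, (0:R) <= (fun _ : nat => (0:R)) i <= 1.
Proof. by move=> i /=; rewrite lexx ler01. Qed.
HB.instance Definition _ (R : realType) :=
  isPointed.Build (X R) (exist _ _ (X0P R)).

Section Defs.
Context {R : realType}.

Definition shift (x : X R) : X R :=
  @exist (nat -> R) (fun y => forall i, 0 <= y i <= 1)
    (fun i => proj1_sig x i.+1) (fun i => proj2_sig x i.+1).

Definition dX (x y : X R) : R :=
  limn (fun n => \sum_(0 <= i < n) (`|proj1_sig x i - proj1_sig y i| / 2 ^+ i.+1)).

Definition X_open (U : set (X R)) : Prop :=
  forall x, U x -> exists2 e : R, 0 < e & [set y | dX x y < e] `<=` U.

Definition XB := g_sigma_algebraType X_open.

Definition invariant (mu : probability XB R) : Prop :=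
  forall A : set XB, measurable A -> mu (shift @^-1` A) = mu A.

Variable h : R -> R -> R.

Definition phi (x : X R) : R := h (proj1_sig x 0%N) (proj1_sig x 1%N).

Definition alpha : \bar R :=
  ereal_inf [set (\int[mu]_x (phi x)%:E)%E | mu in [set mu | invariant mu]].

Definition minimizing (mu : probability XB R) : Prop :=
  invariant mu /\ (\int[mu]_x (phi x)%:E)%E = alpha.

Definition support (mu : probability XB R) : set (X R) :=
  [set x | forall e : R, 0 < e -> (0 < mu [set y : XB | (dX x y < e)%R])%E].

Definition Mather : set (X R) :=
  [set x | exists mu : probability XB R, minimizing mu /\ support mu x].

Definition Bset (x y : X R) (n : nat) (e : R) : set (X R) :=
  [set z | dX x z < e /\ dX (iter n shift z) y < e].

Definition S_eps (x y : X R) (e : R) : \bar R :=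
  ereal_inf [set r | exists n : nat, exists z : X R,
    [/\ (0 < n)%N, Bset x y n e z &
        r = (\sum_(i < n) (phi (iter i shift z) - fine alpha))%:E]].

Definition Mane (x y : X R) : \bar R :=
  lim (S_eps x y e @[e --> 0^'+]).

Definition Aubry : set (X R) := [set x | Mane x x = 0%E].

Definition hstar : R := inf [set h x x | x in `[0, 1]].
Definition mh : set R := [set a | 0 <= a <= 1 /\ h a a = hstar].

End Defs.

Definition D1 {R : realType} (h : R -> R -> R) : R -> R -> R :=
  fun x y => derive1 (fun t => h t y) x.
Definition D2 {R : realType} (h : R -> R -> R) : R -> R -> R :=
  fun x y => derive1 (fun s => h x s) y.

Definition partials_exist {R : realType} (f : R -> R -> R) (p : R * R) : Prop :=
  derivable (fun t => f t p.2) p.1 1 /\ derivable (fun s => f p.1 s) p.2 1.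

Definition cont2 {R : realType} (f : R -> R -> R) (p : R * R) : Prop :=
  {for p, continuous (fun q : R * R => f q.1 q.2)}.

Definition C2_on {R : realType} (U : set (R * R)) (h : R -> R -> R) : Prop :=
  forall p, U p ->
    [/\ partials_exist h p, partials_exist (D1 h) p, partials_exist (D2 h) p &
     [/\ cont2 h p, cont2 (D1 h) p, cont2 (D2 h) p, cont2 (D1 (D1 h)) p &
         [/\ cont2 (D2 (D1 h)) p, cont2 (D1 (D2 h)) p & cont2 (D2 (D2 h)) p]]].

Definition unit_square {R : realType} : set (R * R) :=
  [set p | 0 <= p.1 <= 1 /\ 0 <= p.2 <= 1].

(* Main.v *)
Require Import Defs.
From HB Require Import structures.
From mathcomp Require Import all_boot all_order all_algebra.
From mathcomp Require Import all_classical all_reals all_analysis.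
From mathcomp Require Import measurable_realfun lra.
(* Reimported because the libraries above shadow [shift] and [invariant]. *)
Import Defs.
Import Order.TTheory GRing.Theory Num.Theory.
Import numFieldNormedType.Exports.
Set Implicit Arguments.
Unset Strict Implicit.
Unset Printing Implicit Defensive.
Local Open Scope classical_set_scope.
Local Open Scope ring_scope.

(** Let [v' s = - D1 h s s] on [[0, 1]]. As [D1 h x] is decreasing,
    [x |-> h x y + v x] has its strict minimum at [x = y]. Hence [u x = v (x 0)]
    is a subaction: the reduced cost [phi h - hstar h - u \o shift + u] is
    nonnegative, and it vanishes at [x] only if [x 0 = x 1] lies in [mh h]. The
    coboundary [u \o shift - u] has integral [0] for invariant measures and
    telescopes along orbits. Therefore [alpha h = hstar h], the reduced cost
    vanishes on the support of a minimizing measure, and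
    [Mane h x y >= reduced_cost x + u y - u x], so that it vanishes on the Aubry
    set too. As both sets are forward invariant, it vanishes along whole orbits,
    which are therefore constant. *)

(** * The metric space of sequences *)

Definition entry {R : realType} (x : X R) : nat -> R := proj1_sig x.
Coercion entry : X >-> Funclass.

Section Distance.
Context {R : realType}.
Implicit Types (x y z : X R) (a e : R).

Lemma entry01 x i : 0 <= x i <= 1.
Proof. exact: (proj2_sig x). Qed.

Lemma entry_itv x i : x i \in `[0, 1].
Proof. by rewrite in_itv/= entry01. Qed.

Lemma eq_entry x y : x =1 y -> x = y.
Proof. by case: x y => [x px] [y py] /funext; exact: eq_exist. Qed.

Definition const_seq a (a01 : 0 <= a <= 1) : X R :=
  exist (fun f => forall i : nat, 0 <= f i <= 1) (fun=> a) (fun=> a01).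

Lemma iter_shiftE n x i : iter n shift x i = x (n + i)%N.
Proof. by elim: n i => //= n IHn i; rewrite [LHS]IHn addnS. Qed.

Local Notation dX_term x y := (fun i => `|x i - y i| / 2 ^+ i.+1).
Local Notation half_pow := (fun i => 1 / 2 ^+ i.+1 : R).

Lemma dX_term_ge0 x y i : 0 <= dX_term x y i.
Proof. by rewrite divr_ge0 ?exprn_ge0. Qed.

Lemma dX_term_le x y i : dX_term x y i <= half_pow i.
Proof.
rewrite ler_pM2r ?invr_gt0 ?exprn_gt0// ler_norml.
by have := entry01 x i; have := entry01 y i; lra.
Qed.

Lemma cvg_half_pow : series half_pow @ \oo --> (1 : R).
Proof.
have := @cvg_geometric_series_half R 1 0; rewrite expr0 divr1.
by under eq_fun => i do rewrite addn1 natrX.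
Qed.

Lemma is_cvg_dX x y : cvgn (series (dX_term x y)).
Proof.
apply: series_le_cvg (dX_term_ge0 x y) _ (dX_term_le x y) (cvgP _ cvg_half_pow).
by move=> i; rewrite divr_ge0.
Qed.

Lemma dX_ge0 x y : 0 <= dX x y.
Proof.
apply: limr_ge; first exact: is_cvg_dX.
by apply: nearW => n; apply: sumr_ge0 => i _; exact: dX_term_ge0.
Qed.

Lemma dX_le1 x y : dX x y <= 1.
Proof.
rewrite -(cvg_lim _ cvg_half_pow)//; apply: ler_lim.
- exact: is_cvg_dX.
- exact: cvgP cvg_half_pow.
- by apply: nearW => n; apply: ler_sum => i _; exact: dX_term_le.
Qed.

Lemma dX_recl x y : dX x y = (`|x 0%N - y 0%N| + dX (shift x) (shift y)) / 2.
Proof.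
apply: cvg_lim => //; rewrite -(cvg_shiftS (series (dX_term x y))).
rewrite (_ : (fun n => _) =
    (fun n => (`|x 0%N - y 0%N| + series (dX_term (shift x) (shift y)) n) / 2)).
  by apply: cvgMl; apply: cvgD; [exact: cvg_cst|exact: is_cvg_dX].
apply/funext => n; rewrite /series/= big_nat_recl//= mulrDl mulr_suml.
by congr (_ + _); apply: eq_bigr => i _; rewrite [in LHS]exprSr invfM mulrA.
Qed.

Lemma dX_shift x y : dX (shift x) (shift y) <= 2 * dX x y.
Proof. by rewrite (dX_recl x y); have := normr_ge0 (x 0%N - y 0%N); lra. Qed.

Lemma entry_dist_le i x y : `|x i - y i| <= 2 ^+ i.+1 * dX x y.
Proof.
elim: i x y => [|i IHi] x y.
  rewrite (dX_recl x y) expr1; have := dX_ge0 (shift x) (shift y); lra.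
apply: le_trans (IHi (shift x) (shift y)) _.
by rewrite [in leRHS]exprSr -mulrA ler_wpM2l ?exprn_ge0// dX_shift.
Qed.

Lemma dX_le_prefix n x y e : 0 <= e ->
  (forall i, (i < n)%N -> `|x i - y i| <= e) -> dX x y <= e + 2 ^- n.
Proof.
move=> e0; elim: n x y => [|n IHn] x y xy.
  by have := dX_le1 x y; rewrite expr0 invr1; lra.
rewrite dX_recl exprS invfM; have := xy 0%N isT.
have : dX (shift x) (shift y) <= e + 2 ^- n by apply: IHn => i; exact: xy i.+1.
lra.
Qed.

Lemma dXxx x : dX x x = 0.
Proof.
apply: cvg_lim => //; rewrite (_ : (fun n => _) = cst 0); first exact: cvg_cst.
by apply/funext => n; rewrite big1// => i _; rewrite subrr normr0 mul0r.
Qed.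

Lemma dX0_eq x y : dX x y = 0 -> x = y.
Proof.
move=> xy0; apply: eq_entry => i; apply/eqP; rewrite -subr_eq0 -normr_le0.
by have := entry_dist_le i x y; rewrite xy0 mulr0.
Qed.

Lemma dX_sym x y : dX x y = dX y x.
Proof.
congr (lim (_ @ \oo)); apply/funext => n.
by apply: eq_bigr => i _; rewrite distrC.
Qed.

Lemma dX_triangle y x z : dX x z <= dX x y + dX y z.
Proof.
rewrite -limD; [|exact: is_cvg_dX..]; apply: ler_lim.
- exact: is_cvg_dX.
- by apply: is_cvgD; exact: is_cvg_dX.
- apply: nearW => n; rewrite -[leRHS]big_split; apply: ler_sum => i _ /=.
  by rewrite -mulrDl ler_pM2r ?invr_gt0 ?exprn_gt0// ler_distD.
Qed.

HB.instance Definition _ :=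
  @isMetric.Build R (X R) dX dXxx dX0_eq dX_sym dX_triangle.

End Distance.

Lemma continuous_comp_within {T U V : topologicalType} (A : set U)
    (f : T -> U) (g : U -> V) :
  continuous f -> (forall x, A (f x)) -> {within A, continuous g} ->
  continuous (g \o f).
Proof.
move=> f_cont fA /subspace_continuousP g_cont x.
apply: (@cvg_comp _ _ _ f g _ (within A (nbhs (f x)))) => [P /f_cont|].
  by apply: (filterS (F := nbhs x)) => y; apply; exact: fA.
by apply: g_cont; exact: fA.
Qed.

Section Topology.
Context {R : realType}.
Implicit Types (x y z : X R) (e : R).

Lemma nbhs_dXP x (P : set (X R)) :
  nbhs x P <-> exists2 d : R, 0 < d & [set y | dX x y < d] `<=` P.
Proof. by split=> [/nbhs_ballP|xP]; last apply/nbhs_ballP. Qed.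

Lemma continuous_dXP (T : pseudoMetricType R) (f : X R -> T) :
  continuous f <-> forall x e, 0 < e ->
    exists2 d : R, 0 < d & forall y, dX x y < d -> ball (f x) e (f y).
Proof.
split=> [fc x e e0|fc x].
  by apply/nbhs_dXP; apply: fc; exact: nbhsx_ballx.
by apply/(cvg_ballP (F := nbhs x)) => e e0; apply/nbhs_dXP; exact: fc.
Qed.

Lemma continuous_dist_lt (f : X R -> R) x e : continuous f -> 0 < e ->
  exists2 d : R, 0 < d & forall y, dX x y < d -> `|f x - f y| < e.
Proof. by move=> /continuous_dXP; exact. Qed.

Lemma X_openE : @X_open R = @open (X R).
Proof.
apply/funext => U; apply/propext; rewrite openE.
by split=> oU x /oU /nbhs_dXP.
Qed.

Lemma X_open_ball x e : X_open [set y | dX x y < e].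
Proof.
move=> y /= xy; exists (e - dX x y); first by rewrite subr_gt0.
by move=> z yz; apply: le_lt_trans (dX_triangle y x z) _; rewrite -ltrBrDl.
Qed.

Lemma entry_continuous i : continuous (fun x : X R => x i).
Proof.
apply/continuous_dXP => x e e0; exists (e / 2 ^+ i.+1).
  by rewrite divr_gt0 ?exprn_gt0.
move=> y; rewrite ltr_pdivlMr ?exprn_gt0// mulrC.
exact: le_lt_trans (entry_dist_le i x y).
Qed.

Lemma shift_continuous : continuous (@shift R).
Proof.
apply/continuous_dXP => x e e0; exists (e / 2); first by rewrite divr_gt0.
move=> y; rewrite ltr_pdivlMr// mulrC.
exact: le_lt_trans (dX_shift x y).
Qed.

Lemma comp_shift_continuous (f : X R -> R) :
  continuous f -> continuous (f \o shift).
Proof.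
move=> f_cont x; apply: continuous_comp; first exact: shift_continuous.
exact: f_cont.
Qed.

Lemma near_ptws_prefix (f : {ptws nat -> R}) n e : 0 < e ->
  \forall g \near f, forall i : 'I_n, `|f i - g (val i)| < e.
Proof.
move=> e0; apply: (filter_forall (nbhs_filter f)) => i.
have /cvgrPdist_lt : (fun g : {ptws nat -> R} => g (val i)) @ f --> f (val i).
  exact: (@proj_continuous _ (fun=> R)).
exact.
Qed.

(* [X R] is a continuous image of the Tychonoff cube. *)
Lemma compact_sequences : compact [set: X R].
Proof.
pose cube : set {ptws nat -> R} := [set f | forall i, `[0, 1]%classic (f i)].
pose to_X (f : {ptws nat -> R}) : X R :=
  if pselect (forall i, 0 <= f i <= 1) is left f01 then exist _ f f01 else point.
have to_XE f i : cube f -> to_X f i = f i.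
  rewrite /to_X; case: pselect => [//|not_f01 f_cube]; exfalso.
  by apply: not_f01 => j; have := f_cube j; rewrite /= in_itv.
have to_X_cont : {within cube, continuous to_X}.
  apply/subspace_continuousP => f f_cube; apply/cvg_ballP => e e0.
  have e2 : 0 < e / 2 by rewrite divr_gt0.
  have [n _ /(_ n (leqnn n))] := near_infty_natSinv_expn_lt (PosNum e2).
  rewrite /= div1r near_withinE => n_large.
  have near_f := near_ptws_prefix f n e2.
  apply: (filterS (F := nbhs f)) near_f => g fg g_cube.
  rewrite /ball/=.
  apply: (@le_lt_trans _ _ (e / 2 + 2 ^- n)); last lra.
  apply: dX_le_prefix => [|i i_lt_n]; first exact: ltW.
  by rewrite !to_XE//; exact: ltW (fg (Ordinal i_lt_n)).
have <- : to_X @` cube = setT.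
  apply/seteqP; split=> // x _.
  have x_cube : cube (entry x) by move=> i; exact: entry_itv.
  by exists (entry x) => //; apply: eq_entry => i; exact: to_XE.
apply: continuous_compact to_X_cont _.
apply: (@tychonoff _ (fun=> R) (fun=> `[0, 1]%classic)) => i.
exact: segment_compact.
Qed.

End Topology.

(** * Borel measures on the space of sequences *)

Section BorelMeasures.
Context {R : realType}.
Local Notation XB := (XB (R := R)).
Implicit Types (mu : probability XB R) (x y p : X R) (f : X R -> R).

Lemma measurable_open (U : set (X R)) : open U -> measurable (U : set XB).
Proof. by rewrite -X_openE; exact: sub_sigma_algebra. Qed.

Lemma measurable_ball_dX x (e : R) : measurable ([set y | dX x y < e] : set XB).
Proof. by apply: sub_sigma_algebra; exact: X_open_ball. Qed.

Lemma continuous_measurable f :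
  continuous f -> measurable_fun setT (f : XB -> R).
Proof.
move=> f_cont; apply: (measurability _ (RGenOInfty.measurableE R)).
move=> _ [_ [a ->] <-]; rewrite setTI; apply: measurable_open.
by apply: open_comp (interval_open _ _) => // x _; exact: f_cont.
Qed.

Lemma measurable_shift : measurable_fun setT (shift : XB -> XB).
Proof.
have borelE : @measurable _ XB = <<s @X_open R >> by [].
apply: (measurability _ borelE) => _ [U openU <-]; rewrite setTI.
apply: measurable_open; apply: (@open_comp (X R) (X R) shift) => [x _|].
  exact: shift_continuous.
by rewrite -X_openE.
Qed.

Lemma integrable_continuous mu f :
  continuous f -> mu.-integrable setT (EFin \o f).
Proof.
move=> f_cont; apply: measurable_bounded_integrable => //.
- exact: fin_num_fun_lty.
- exact: continuous_measurable.
- have : {within [set: X R], continuous f} by exact: continuous_subspaceT.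
  move/continuous_compact/(_ compact_sequences)/compact_bounded => [M [Mreal fM]].
  by exists M; split=> // N MN x _; apply: fM => //; exists x.
Qed.

Lemma integral_shift mu (f : XB -> \bar R) : invariant mu ->
  measurable_fun setT f -> mu.-integrable setT (f \o shift) ->
  (\int[mu]_x f (shift x) = \int[mu]_x f x)%E.
Proof.
move=> mu_inv f_meas f_int.
transitivity (\int[pushforward mu (shift : XB -> XB)]_x f x)%E.
  by rewrite (integral_pushforward measurable_shift) ?preimage_setT.
apply: eq_measure_integral => [|? A mA _]; first exact: measurable_shift.
exact: mu_inv.
Qed.

Lemma integral_coboundary mu f : invariant mu -> continuous f ->
  (\int[mu]_x (f (shift x) - f x)%:E = 0)%E.
Proof.
move=> mu_inv f_cont; have int_f := integrable_continuous mu f_cont.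
have int_f_shift := integrable_continuous mu (comp_shift_continuous f_cont).
under eq_integral => x _ do rewrite EFinB.
rewrite integralB// (integral_shift (f := EFin \o f))//.
  by rewrite subee//; exact: integrable_fin_num.
by apply/measurable_EFinP; exact: continuous_measurable.
Qed.

Lemma support_shift mu x : invariant mu ->
  Defs.support mu x -> Defs.support mu (shift x).
Proof.
move=> mu_inv supp_x e e0; rewrite -mu_inv; last exact: measurable_ball_dX.
apply: lt_le_trans (supp_x (e / 2) _) _; first by rewrite divr_gt0.
apply: le_measure; rewrite ?inE.
- exact: measurable_ball_dX.
- rewrite -[X in measurable X]setTI; apply: measurable_shift => //.
  exact: measurable_ball_dX.
- move=> y /=; rewrite ltr_pdivlMr// mulrC; exact: le_lt_trans (dX_shift x y).
Qed.

Lemma integral_eq0_support mu f x : continuous f -> (forall y, 0 <= f y) ->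
  (\int[mu]_y (f y)%:E = 0)%E -> Defs.support mu x -> f x = 0.
Proof.
move=> f_cont f_ge0 int_f0 supp_x; apply: contrapT => /eqP fx_neq0.
have : nbhs (f x) [set t | t != 0].
  by apply: open_nbhs_nbhs; split=> //; exact: open_neq.
move=> /f_cont/nbhs_dXP[d d0 ball_f_neq0].
have f_meas : measurable_fun setT (EFin \o f : XB -> \bar R).
  by apply/measurable_EFinP; exact: continuous_measurable.
have /(ae_eq_integral_abs mu measurableT f_meas)[N [mN N0 f_eq0_offN]] :
    (\int[mu]_y `|(f y)%:E| = 0)%E.
  by rewrite -int_f0; apply: eq_integral => y _; rewrite gee0_abs ?lee_fin.
have := supp_x d d0; apply/negP; rewrite -leNgt -N0; apply: le_measure.
- by rewrite inE; exact: measurable_ball_dX.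
- by rewrite inE.
- move=> y /ball_f_neq0/eqP fy_neq0; apply: f_eq0_offN => /(_ I).
  by move=> [].
Qed.

Lemma invariant_dirac p : shift p = p ->
  invariant (\d_(p : XB) : probability XB R).
Proof. by move=> p_fix A _; rewrite /= !diracE -[in RHS]p_fix. Qed.

Lemma support_dirac p : Defs.support (\d_(p : XB) : probability XB R) p.
Proof. by move=> e e0; rewrite /= diracE mem_set//= dXxx. Qed.

End BorelMeasures.

(** * Minimizing measures and the Mane potential *)

Section MinimizingSets.
Context {R : realType} (h : R -> R -> R).
Implicit Types (x y z p : X R) (e : R).

Definition birkhoff_sum n z : R :=
  \sum_(i < n) (phi h (iter i shift z) - fine (alpha h)).

Lemma birkhoff_sum_shift n z :
  birkhoff_sum n (shift z) =
  birkhoff_sum n z + phi h (iter n shift z) - phi h z.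
Proof.
elim: n => [|n IHn]; first by rewrite /birkhoff_sum !big_ord0/=; lra.
rewrite /birkhoff_sum !big_ord_recr -!/(birkhoff_sum n _) IHn -iterSr/=; lra.
Qed.

Lemma S_eps_le_birkhoff_sum x y e n z : (0 < n)%N -> Bset x y n e z ->
  (S_eps h x y e <= (birkhoff_sum n z)%:E)%E.
Proof. by move=> n0 Bz; apply: ereal_inf_lbound; exists n, z. Qed.

Lemma le_S_eps x y e (a : \bar R) :
  (forall n z, (0 < n)%N -> Bset x y n e z -> (a <= (birkhoff_sum n z)%:E)%E) ->
  (a <= S_eps h x y e)%E.
Proof.
by move=> a_le; apply: le_ereal_inf_tmp => _ [n [z [n0 Bz ->]]]; exact: a_le.
Qed.

Lemma Mane_sup x y :
  Mane h x y = ereal_sup [set S_eps h x y e | e in `]0, +oo[].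
Proof.
apply: cvg_lim => //; apply: nonincreasing_at_right_cvge => // d e _ _ de.
apply: ereal_inf_le_tmp => _ [n [z [n0 [xz zy] ->]]].
by exists n, z; split=> //; split; exact: lt_le_trans de.
Qed.

Lemma S_eps_le_Mane x y e : 0 < e -> (S_eps h x y e <= Mane h x y)%E.
Proof.
move=> e0; rewrite Mane_sup; apply: ereal_sup_ubound.
by exists e; rewrite //= in_itv/= andbT.
Qed.

Lemma Mane_le x y (a : \bar R) :
  (forall e, 0 < e -> (S_eps h x y e <= a)%E) -> (Mane h x y <= a)%E.
Proof.
move=> S_le; rewrite Mane_sup; apply: ge_ereal_sup => _ [e /= + <-].
by rewrite in_itv/= andbT; exact: S_le.
Qed.

Lemma le_Mane x y (a : R) :
  (forall eta : R, 0 < eta -> exists2 d : R, 0 < d &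
    forall n z, (0 < n)%N -> Bset x y n d z -> a - eta <= birkhoff_sum n z) ->
  (a%:E <= Mane h x y)%E.
Proof.
move=> a_le; apply/lee_addgt0Pr => eta /a_le[d d0 sum_ge]; rewrite -leeBlDr//.
apply: le_trans (S_eps_le_Mane x y d0); apply: le_S_eps => n z n0 Bz.
by rewrite lee_fin; exact: sum_ge.
Qed.

(* An orbit segment from near [x] to near [y], shifted by one step, leads from
   near [shift x] to near [shift y]. *)
Lemma Mane_shift_le x y : continuous (phi h) ->
  (Mane h (shift x) (shift y) <= Mane h x y + (phi h y - phi h x)%:E)%E.
Proof.
move=> phi_cont; apply: Mane_le => e e0; apply/lee_addgt0Pr => eta eta0.
have eta2 : 0 < eta / 2 by rewrite divr_gt0.
have [dx dx0 phi_x] := continuous_dist_lt x phi_cont eta2.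
have [dy dy0 phi_y] := continuous_dist_lt y phi_cont eta2.
pose d := Num.min (e / 2) (Num.min dx dy).
have d0 : 0 < d by rewrite !lt_min dx0 dy0 divr_gt0.
rewrite -addeA -EFinD -leeBlDr//.
apply: le_trans (S_eps_le_Mane x y d0); apply: le_S_eps => n z n0 [].
rewrite leeBlDr// !lt_min => /and3P[xz /phi_x phi_xz _] /and3P[zy _ zy'].
have /phi_y phi_yz : dX y (iter n shift z) < dy by rewrite dX_sym.
apply: le_trans (S_eps_le_birkhoff_sum (z := shift z) n0 _) _.
  split.
    by apply: le_lt_trans (dX_shift x z) _; rewrite mulrC -ltr_pdivlMr.
  rewrite -iterSr iterS; apply: le_lt_trans (dX_shift _ y) _.
  by rewrite mulrC -ltr_pdivlMr.
rewrite birkhoff_sum_shift lee_fin.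
by move: phi_xz phi_yz; rewrite !ltr_norml => /andP[? ?] /andP[? ?]; lra.
Qed.

Lemma integral_phi_dirac p : continuous (phi h) ->
  (\int[(\d_(p : XB) : probability XB R)]_x (phi h x)%:E = (phi h p)%:E)%E.
Proof.
move=> phi_cont; rewrite integral_dirac//; first by rewrite diracT mul1e.
by apply/measurable_EFinP; exact: continuous_measurable.
Qed.

Lemma alpha_le_fixed_point p : continuous (phi h) -> shift p = p ->
  (alpha h <= (phi h p)%:E)%E.
Proof.
move=> phi_cont p_fix; rewrite -integral_phi_dirac//; apply: ereal_inf_lbound.
by exists (\d_(p : XB)) => //; exact: invariant_dirac.
Qed.

Lemma Mather_fixed_point p : continuous (phi h) -> shift p = p ->
  alpha h = (phi h p)%:E -> Mather h p.
Proof.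
move=> phi_cont p_fix alphaE; exists (\d_(p : XB)).
split; last exact: support_dirac.
by split; [exact: invariant_dirac|rewrite integral_phi_dirac].
Qed.

Lemma Mather_shift x : Mather h x -> Mather h (shift x).
Proof.
move=> [mu [mu_min supp_x]]; exists mu; split=> //.
by apply: support_shift => //; case: mu_min.
Qed.

Lemma Mane_fixed_point_le0 p : shift p = p -> alpha h = (phi h p)%:E ->
  (Mane h p p <= 0)%E.
Proof.
move=> p_fix alphaE; apply: Mane_le => e e0.
apply: le_trans (S_eps_le_birkhoff_sum (n := 1) (z := p) _ _) _ => //.
  by split; rewrite /= ?p_fix dXxx.
by rewrite /birkhoff_sum big_ord1 alphaE/= subrr.
Qed.

End MinimizingSets.

Section Subaction.
Context {R : realType} (h : R -> R -> R) (u : X R -> R) (c : R).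
Implicit Types (x y z : X R).

Definition reduced_cost x : R := phi h x - c - u (shift x) + u x.

Definition subaction : Prop := continuous u /\ forall x, 0 <= reduced_cost x.

Hypothesis phi_cont : continuous (phi h).
Hypothesis u_subaction : subaction.

Let u_cont : continuous u := u_subaction.1.
Let reduced_ge0 : forall x, 0 <= reduced_cost x := u_subaction.2.

Lemma reduced_cost_continuous : continuous reduced_cost.
Proof.
move=> x; apply: (@continuousD _ _ (X R)); last exact: u_cont.
apply: (@continuousB _ _ (X R)); last exact: comp_shift_continuous.
by apply: (@continuousB _ _ (X R)); [exact: phi_cont|exact: cst_continuous].
Qed.

Lemma integral_phi_reduced (mu : probability (XB (R := R)) R) : invariant mu ->
  (\int[mu]_x (phi h x)%:E = c%:E + \int[mu]_x (reduced_cost x)%:E)%E.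
Proof.
move=> mu_inv.
have int_red := integrable_continuous mu reduced_cost_continuous.
have int_cobound : mu.-integrable setT (fun x => (u (shift x) - u x)%:E).
  apply: integrable_continuous => x.
  by apply: (@continuousB _ _ (X R)); [exact: comp_shift_continuous|exact: u_cont].
have int_c : mu.-integrable setT (EFin \o cst c).
  exact: finite_measure_integrable_cst.
transitivity (\int[mu]_x (c%:E + (reduced_cost x)%:E + (u (shift x) - u x)%:E))%E.
  by apply: eq_integral => x _; rewrite -!EFinD /reduced_cost; congr EFin; lra.
rewrite integralD//; last exact: integrableD.
rewrite integral_coboundary// adde0 integralD//.
by rewrite (integral_cst mu measurableT) [X in (_ * X)%E]probability_setT mule1.
Qed.

Lemma subaction_alpha_ge : (c%:E <= alpha h)%E.
Proof.
apply: le_ereal_inf_tmp => _ [mu mu_inv <-].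
rewrite integral_phi_reduced// leeDl//.
by apply: integral_ge0 => x _; rewrite lee_fin.
Qed.

Lemma sum_phi_reduced n z :
  \sum_(i < n) (phi h (iter i shift z) - c) =
  \sum_(i < n) reduced_cost (iter i shift z) + u (iter n shift z) - u z.
Proof.
elim: n => [|n IHn]; first by rewrite !big_ord0 add0r subrr.
rewrite !big_ord_recr/= IHn /reduced_cost; lra.
Qed.

Hypothesis alphaE : alpha h = c%:E.

Lemma Mather_reduced_eq0 x : Mather h x -> reduced_cost x = 0.
Proof.
move=> [mu [[mu_inv]]]; rewrite alphaE integral_phi_reduced// => int_phi supp_x.
apply: integral_eq0_support reduced_cost_continuous reduced_ge0 _ supp_x.
move: int_phi; case: (\int[mu]_y _)%E => [r| |]//=; rewrite -EFinD => -[].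
by move=> /eqP; rewrite addrC -subr_eq0 addrK => /eqP ->.
Qed.

Lemma Mane_ge_reduced_cost x y :
  ((reduced_cost x + u y - u x)%:E <= Mane h x y)%E.
Proof.
apply: le_Mane => eta eta0; have eta3 : 0 < eta / 3 by rewrite divr_gt0.
have [d1 d1_gt0 red_x] := continuous_dist_lt x reduced_cost_continuous eta3.
have [d2 d2_gt0 u_x] := continuous_dist_lt x u_cont eta3.
have [d3 d3_gt0 u_y] := continuous_dist_lt y u_cont eta3.
exists (Num.min d1 (Num.min d2 d3)); first by rewrite !lt_min d1_gt0 d2_gt0.
case=> // n z _ []; rewrite [X in _ -> X < _ -> _]dX_sym.
rewrite !lt_min => /and3P[/red_x red_xz /u_x u_xz _] /and3P[_ _ /u_y u_yz].
rewrite /birkhoff_sum alphaE sum_phi_reduced big_ord_recl/=.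
have : 0 <= \sum_(i < n) reduced_cost (iter (bump 0 i) shift z).
  by apply: sumr_ge0 => i _; exact: reduced_ge0.
move: red_xz u_xz u_yz; rewrite !ltr_norml => /andP[? ?] /andP[? ?] /andP[? ?].
lra.
Qed.

Lemma Mane_loop_ge0 x : (0 <= Mane h x x)%E.
Proof.
by apply: le_trans (Mane_ge_reduced_cost x x); rewrite lee_fin addrK.
Qed.

Lemma Aubry_reduced_eq0 x : Aubry h x -> reduced_cost x = 0.
Proof.
move=> Mane0; apply/eqP; rewrite eq_le reduced_ge0 andbT.
by have := Mane_ge_reduced_cost x x; rewrite Mane0 addrK lee_fin.
Qed.

Lemma Aubry_shift x : Aubry h x -> Aubry h (shift x).
Proof.
move=> Mane0; apply/eqP; rewrite eq_le Mane_loop_ge0 andbT.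
by apply: le_trans (Mane_shift_le x x phi_cont) _; rewrite Mane0 subrr adde0.
Qed.

Lemma Aubry_fixed_point p : shift p = p -> phi h p = c -> Aubry h p.
Proof.
move=> p_fix phi_p; apply/eqP; rewrite eq_le Mane_loop_ge0 andbT.
by apply: Mane_fixed_point_le0 => //; rewrite phi_p.
Qed.

End Subaction.

(** * The twist condition *)

Section DiagonalPotential.
Context {R : realType}.
Implicit Types (f v : R -> R) (h : R -> R -> R) (a b c : R).

Lemma within_continuous_antiderivative f a b : a < b ->
  {within `[a, b], continuous f} ->
  exists2 F : R -> R, {within `[a, b], continuous F} &
    {in `]a, b[, forall x, derivable F x 1 /\ derive1 F x = f x}.
Proof.
move=> ab f_cont.
have f_int : (@lebesgue_measure R).-integrable `[a, b] (EFin \o f).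
  by apply: continuous_compact_integrable f_cont; exact: segment_compact.
exists (fun x => \int[lebesgue_measure]_(t in `[a, x]) f t).
  exact: parameterized_integral_continuous (ltW ab) f_int.
have [f_cont_oo _ _] := (continuous_within_itvP f ab).1 f_cont.
move=> x x_ab; have := x_ab; rewrite in_itv/= => /andP[ax xb].
by apply: continuous_FTC1_closed xb f_int ax _; exact: f_cont_oo.
Qed.

Lemma derive1_strict_min f a b c : {within `[a, b], continuous f} ->
  {in `]a, b[, forall x, derivable f x 1} ->
  {in `]a, c[, forall x, derive1 f x < 0} ->
  {in `]c, b[, forall x, 0 < derive1 f x} ->
  c \in `[a, b] -> {in `[a, b], forall x, x != c -> f c < f x}.
Proof.
move=> f_cont f_deriv f'_lt0 f'_gt0; rewrite in_itv/= => /andP[ac cb] x.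
rewrite in_itv/= => /andP[ax xb]; rewrite neq_lt => /orP[xc|cx].
- apply: (@ltr0_derive1_decr _ f a c) => // [t|].
    rewrite in_itv/= => /andP[a_t tc].
    by apply: f_deriv; rewrite in_itv/= a_t (lt_le_trans tc).
  by apply: continuous_subspaceW f_cont; exact: subset_itvl.
- apply: (@gtr0_derive1_incr _ f c b) => // [t|].
    rewrite in_itv/= => /andP[ct tb].
    by apply: f_deriv; rewrite in_itv/= tb (le_lt_trans ac).
  by apply: continuous_subspaceW f_cont; exact: subset_itvr.
Qed.

(* [v' s = - D1 h s s]: the derivative of [h^~ y + v] at [x] is then
   [D1 h x y - D1 h x x], which has the sign of [x - y]. *)
Lemma exists_diagonal_potential h a b : a < b ->
  {in `[a, b] &, forall x y, derivable (h^~ y) x 1} ->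
  {in `[a, b], forall x, {in `[a, b] &, {homo D1 h x : y z /~ y < z}}} ->
  {within `[a, b], continuous (fun s => D1 h s s)} ->
  exists2 v : R -> R, {within `[a, b], continuous v} &
    {in `[a, b] &, forall x y, x != y -> h y y + v y < h x y + v x}.
Proof.
move=> ab h_deriv D1_decr D1_cont.
have [|v v_cont v'E] :=
  @within_continuous_antiderivative (fun s => - D1 h s s) a b ab.
  by move=> s; apply: cvgN; exact: D1_cont.
exists v => // x y x_ab y_ab; pose f t := h t y + v t.
have sub_cc : {subset `]a, b[ <= `[a, b]} by exact: subset_itv_oo_cc.
have f'E : {in `]a, b[, forall t,
    derivable f t 1 /\ derive1 f t = D1 h t y - D1 h t t}.
  move=> t t_ab; have [dv v't] := v'E t t_ab.
  have dh := h_deriv t y (sub_cc t t_ab) y_ab.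
  by split; [exact: derivableD|rewrite derive1E deriveD// -!derive1E v't].
have sub_ay : {subset `]a, y[ <= `]a, b[}.
  by apply: subset_itvl; rewrite bnd_simp (itvP y_ab).
have sub_yb : {subset `]y, b[ <= `]a, b[}.
  by apply: subset_itvr; rewrite bnd_simp (itvP y_ab).
apply: (@derive1_strict_min f a b y) => // [t|t /f'E[]//|t t_ay|t t_yb].
- apply: cvgD; last exact: v_cont.
  by apply: derivable_within_continuous => s s_ab; exact: h_deriv.
- have t_ab := sub_ay t t_ay; rewrite (f'E t t_ab).2 subr_lt0.
  by apply: D1_decr => //; [exact: sub_cc..|rewrite (itvP t_ay)].
- have t_ab := sub_yb t t_yb; rewrite (f'E t t_ab).2 subr_gt0.
  by apply: D1_decr => //; [exact: sub_cc..|rewrite (itvP t_yb)].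
Qed.

End DiagonalPotential.

Section TwistOnSquare.
Context {R : realType} (h : R -> R -> R) (U : set (R * R)).
Hypothesis squareU : unit_square `<=` U.
Hypothesis h_C2 : C2_on U h.

Lemma C2_on_square s t : s \in `[0, 1] -> t \in `[0, 1] ->
  [/\ derivable (h^~ t) s 1, derivable (D1 h s) t 1 & cont2 (D1 h) (s, t)].
Proof.
rewrite !in_itv/= => s01 t01.
have /squareU/h_C2[[dh _] [_ dD1] _ [_ cD1 _ _ _]] : unit_square (s, t) by [].
by split.
Qed.

Lemma C2_on_square_continuous :
  {within unit_square, continuous (fun q => h q.1 q.2)}.
Proof.
apply: continuous_in_subspaceT => q; rewrite inE => /squareU/h_C2.
by move=> [_ _ _ []].
Qed.

Lemma D1_diagonal_continuous : {within `[0, 1], continuous (fun s => D1 h s s)}.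
Proof.
apply: continuous_in_subspaceT => s; rewrite inE/= => s01.
have [_ _ cD1] := C2_on_square s01 s01.
apply: (@continuous_comp _ _ _ (fun s : R => (s, s)) (fun q => D1 h q.1 q.2)) => //.
exact: (cvg_pair (@cvg_id _ (nbhs s)) (@cvg_id _ (nbhs s))).
Qed.

Hypothesis twist :
  forall s t : R, 0 <= s <= 1 -> 0 <= t <= 1 -> D2 (D1 h) s t < 0.

Lemma D1_decreasing :
  {in `[0, 1], forall s, {in `[0, 1] &, {homo D1 h s : t r /~ t < r}}}.
Proof.
move=> s s01 r t; rewrite !in_itv/= => /andP[_ r1] /andP[t0 _] tr.
apply: (@ltr0_derive1_decr _ (D1 h s) 0 1) => // [q|q|].
- by move=> /subset_itv_oo_cc q01; have [] := C2_on_square s01 q01.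
- by move=> /subset_itv_oo_cc q01; apply: twist.
- apply: derivable_within_continuous => q q01.
  by have [] := C2_on_square s01 q01.
Qed.

Lemma twist_diagonal_potential :
  exists2 v : R -> R, {within `[0, 1], continuous v} &
    {in `[0, 1] &, forall s t, s != t -> h t t + v t < h s t + v s}.
Proof.
apply: exists_diagonal_potential ltr01 _ D1_decreasing D1_diagonal_continuous.
by move=> s t s01 t01; have [] := C2_on_square s01 t01.
Qed.

End TwistOnSquare.

Section Twist.
Context {R : realType} (h : R -> R -> R) (v : R -> R).
Implicit Types (x y : X R) (a : R).

Hypothesis h_cont : {within unit_square, continuous (fun q => h q.1 q.2)}.
Hypothesis v_cont : {within `[0, 1], continuous v}.
Hypothesis v_potential :
  {in `[0, 1] &, forall s t, s != t -> h t t + v t < h s t + v s}.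

Lemma h_entries_continuous i j : continuous (fun x : X R => h (x i) (x j)).
Proof.
apply: (continuous_comp_within (f := fun x : X R => (x i, x j))) h_cont => x.
  exact: (cvg_pair (@entry_continuous R i x) (@entry_continuous R j x)).
by split; exact: entry01.
Qed.

Lemma phi_continuous : continuous (phi h).
Proof. exact: h_entries_continuous. Qed.

Lemma v_entry_continuous i : continuous (fun x : X R => v (x i)).
Proof.
apply: (continuous_comp_within (f := fun x : X R => x i)) v_cont => x.
  exact: entry_continuous.
exact: entry_itv.
Qed.

Lemma diagonal_min : exists2 c, mh h c & {in `[0, 1], forall a, h c c <= h a a}.
Proof.
have [c c01 c_min] :
    exists2 c, c \in `[0, 1] & {in `[0, 1], forall a, h c c <= h a a}.
  have [||x _ x_min] := compact_EVT_min (f := fun x : X R => h (x 0%N) (x 0%N)) _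
    compact_sequences; first by exists point.
    exact/continuous_subspaceT/h_entries_continuous.
  exists (entry x 0%N) => [|a]; first exact: entry_itv.
  by rewrite in_itv/= => a01; apply: (x_min (const_seq a01)); rewrite inE.
exists c => //; split; first by move: c01; rewrite in_itv.
apply/eqP; rewrite eq_le; apply/andP; split.
  by apply: lb_le_inf => [|_ [a a01 <-]]; [exists (h c c), c|exact: c_min].
by apply: ge_inf; [exists (h c c) => _ [a a01 <-]; exact: c_min|exists c].
Qed.

Lemma hstar_le : {in `[0, 1], forall a, hstar h <= h a a}.
Proof. by have [c [_ <-]] := diagonal_min; exact. Qed.

Local Notation reduced := (reduced_cost h (fun x => v (x 0%N)) (hstar h)).

Lemma reducedE x :
  reduced x = h (x 0%N) (x 1%N) - hstar h - v (x 1%N) + v (x 0%N).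
Proof. by []. Qed.

Lemma reduced_leif x :
  h (x 1%N) (x 1%N) - hstar h <= reduced x ?= iff (x 0%N == x 1%N).
Proof.
apply/leifP; rewrite reducedE; have [->|x01] := eqVneq (x 0%N) (x 1%N).
  by apply/eqP; rewrite addrNK.
by have := v_potential (entry_itv x 0) (entry_itv x 1) x01; lra.
Qed.

Lemma reduced_ge0 x : 0 <= reduced x.
Proof.
by apply: le_trans (reduced_leif x); rewrite subr_ge0 hstar_le// entry_itv.
Qed.

Lemma v_subaction : subaction h (fun x => v (x 0%N)) (hstar h).
Proof. by split; [exact: v_entry_continuous|exact: reduced_ge0]. Qed.

Lemma reduced_eq0 x : reduced x = 0 -> x 0%N = x 1%N /\ mh h (x 0%N).
Proof.
move=> red0; have := reduced_leif x; rewrite red0 => -[].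
rewrite subr_le0 => h_le.
have hE : h (x 1%N) (x 1%N) = hstar h.
  by apply/eqP; rewrite eq_le h_le hstar_le ?entry_itv.
rewrite hE subrr eqxx => /esym/eqP x01.
by split=> //; split; [exact: entry01|rewrite x01].
Qed.

Definition constant_minimizers : set (X R) :=
  [set x | exists a, mh h a /\ proj1_sig x = (fun=> a)].

Lemma constant_minimizers_fixed p : constant_minimizers p -> shift p = p.
Proof. by move=> [a [_ pa]]; apply: eq_entry => i; rewrite /entry/= pa. Qed.

Lemma constant_minimizers_phi p : constant_minimizers p -> phi h p = hstar h.
Proof. by move=> [a [[_ ha] pa]]; rewrite /phi pa. Qed.

Lemma alpha_hstar : alpha h = (hstar h)%:E.
Proof.
have [c [c01 hc] _] := diagonal_min.
apply/eqP; rewrite eq_le -{1}hc (alpha_le_fixed_point (p := const_seq c01))/=.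
- exact: subaction_alpha_ge phi_continuous v_subaction.
- exact: phi_continuous.
- exact: eq_entry.
Qed.

Lemma sub_constant_minimizers (A : set (X R)) :
  (forall x, A x -> A (shift x)) -> (forall x, A x -> reduced x = 0) ->
  A `<=` constant_minimizers.
Proof.
move=> A_shift A_reduced0 x Ax; exists (x 0%N).
have A_iter i : A (iter i shift x) by elim: i => //= i; exact: A_shift.
split; first by have [] := reduced_eq0 (A_reduced0 x Ax).
apply/funext; elim=> // i <-.
have [+ _] := reduced_eq0 (A_reduced0 _ (A_iter i)).
by rewrite !iter_shiftE addn0 addn1.
Qed.

Lemma Mather_constant_minimizers : Mather h = constant_minimizers.
Proof.
apply/seteqP; split=> [|p p_min].
  apply: sub_constant_minimizers => x; first exact: Mather_shift.
  exact: Mather_reduced_eq0 phi_continuous v_subaction alpha_hstar x.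
apply: Mather_fixed_point; first exact: phi_continuous.
  exact: constant_minimizers_fixed.
by rewrite (constant_minimizers_phi p_min) alpha_hstar.
Qed.

Lemma Aubry_constant_minimizers : Aubry h = constant_minimizers.
Proof.
apply/seteqP; split=> [|p p_min].
  apply: sub_constant_minimizers => x.
    exact: Aubry_shift phi_continuous v_subaction alpha_hstar x.
  exact: Aubry_reduced_eq0 phi_continuous v_subaction alpha_hstar x.
apply: Aubry_fixed_point phi_continuous v_subaction alpha_hstar _ _ _.
- exact: constant_minimizers_fixed.
- exact: constant_minimizers_phi.
Qed.

End Twist.

Theorem theorem1 (R : realType) (h : R -> R -> R) :
  (exists U : set (R * R), [/\ open U, unit_square `<=` U & C2_on U h]) ->
  (forall x y : R, 0 <= x <= 1 -> 0 <= y <= 1 -> D2 (D1 h) x y < 0) ->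
  Mather h = Aubry h /\
  Aubry h = [set x : X R | exists a : R, mh h a /\ proj1_sig x = (fun _ => a)].
Proof.
move=> [U [_ squareU h_C2]] twist.
have h_cont := C2_on_square_continuous squareU h_C2.
have [v v_cont v_potential] := twist_diagonal_potential squareU h_C2 twist.
by rewrite (Mather_constant_minimizers h_cont v_cont v_potential)
  (Aubry_constant_minimizers h_cont v_cont v_potential).
Qed.
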